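(* Let $\lambda=\frac{\pm1\pm i}{2}$ (any of the four choices of signs). Then $G_\lambda$ is both parabolic dust and non-free. It contains two distinct conjugacy classes of parabolic subgroups isomorphic to $\mathbb{Z}\times\mathbb{Z}$, and thus is not free; it contains four distinct conjugacy classes of parabolic elements, and thus is parabolic dust.
   Context: For $\lambda\in\mathbb{C}\setminus\{0\}$, $G_\lambda=\langle S,T_\lambda\rangle$ is the subgroup of $PSL(2,\mathbb{C})$ generated by (the classes of) $S=\begin{pmatrix}1&0\\1&1\end{pmatrix}$ and $T_\lambda=\begin{pmatrix}1&2\lambda\\0&1\end{pmatrix}$. ''Non-free'' means that $G_\lambda$ is not a free group. A parabolic subgroup is one all of whose non-identity elements are parabolic with a common fixed point. Conjugacy means conjugacy in $G_\lambda$. If $G$ is a subgroup of $PSL(2,\mathbb{C})$, a parabolic element $h\in G$ is a primitive parabolic (of $G$) if $h=g^m$ with $g\in G$ and $m\in\mathbb{Z}$ implies $m=\pm1$. The group $G_\lambda$ is called parabolic dust if it has a third conjugacy class of primitive parabolics, i.e. at least three conjugacy classes; here classes of parabolics are counted as conjugacy classes in $G_\lambda$ of the cyclic subgroups they generate, so that a parabolic and its inverse are not distinguished. *)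

(* Defs.v *)
From HB Require Import structures.
From mathcomp Require Import all_boot all_order all_algebra.
From mathcomp Require Import all_classical all_reals.
From mathcomp Require Export complex.

Set Implicit Arguments.
Unset Strict Implicit.
Unset Printing Implicit Defensive.

Import GRing.Theory.
Local Open Scope classical_set_scope.
Local Open Scope quotient_scope.
Local Open Scope ring_scope.

Section Groups.
Local Open Scope group_scope.
Variable gT : groupType.
Implicit Types (x g h : gT) (X G H P Q A B : set gT).

Definition is_subgroup H : Prop :=
  H 1 /\ forall x y, H x -> H y -> H (x * y^-1).

Definition generated X : set gT := smallest is_subgroup X.

Definition expgz x (m : int) : gT :=
  match m with Posz n => x ^+ n | Negz n => x ^- n.+1 end.

Definition conjugate_in G A B : Prop :=
  exists2 g, G g & B = [set x ^ g | x in A].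

Definition iso_ZxZ P : Prop :=
  exists f : int * int -> gT,
    [/\ forall u v, f (u + v)%R = f u * f v, injective f & range f = P].

(* The letter (x, false) stands for x and (x, true) for its inverse. *)
Definition letter (l : gT * bool) : gT := if l.2 then l.1^-1 else l.1.

Definition word_value (w : seq (gT * bool)) : gT := \prod_(l <- w) letter l.

Definition reduced (w : seq (gT * bool)) : bool :=
  sorted (fun l l' => ~~ ((l.1 == l'.1) && (l.2 != l'.2))) w.

Definition free_basis X G : Prop :=
  generated X = G /\
  forall w : seq (gT * bool), (forall l, l \in w -> X l.1) ->
    reduced w -> w <> [::] -> word_value w <> 1.

Definition is_free G : Prop := exists X, free_basis X G.

End Groups.

Section SpecialLinear.
Variable F : fieldType.

Record SL2 := MkSL2 { mx_of_SL2 :> 'M[F]_2; _ : \det mx_of_SL2 == 1 }.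

HB.instance Definition _ := [isSub for mx_of_SL2].
HB.instance Definition _ := [Choice of SL2 by <:].

Implicit Types A B : SL2.

Lemma det_SL2 A : \det (A : 'M_2) = 1.
Proof. exact/eqP/(valP A). Qed.

Lemma unit_SL2 A : (A : 'M_2) \in unitmx.
Proof. by rewrite unitmxE det_SL2 unitr1. Qed.

Fact SL2_one_subproof : \det (1%:M : 'M[F]_2) == 1.
Proof. by rewrite det1. Qed.
Fact SL2_mul_subproof A B : \det ((A : 'M_2) *m (B : 'M_2)) == 1.
Proof. by rewrite det_mulmx !det_SL2 mulr1. Qed.
Fact SL2_inv_subproof A : \det (invmx (A : 'M_2)) == 1.
Proof. by rewrite det_inv det_SL2 invr1. Qed.
Fact SL2_opp_subproof A : \det (- (A : 'M_2)) == 1.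
Proof. by rewrite -scaleN1r detZ det_SL2 sqrrN expr1n mulr1. Qed.

Definition SL2_one := MkSL2 SL2_one_subproof.
Definition SL2_mul A B := MkSL2 (SL2_mul_subproof A B).
Definition SL2_inv A := MkSL2 (SL2_inv_subproof A).
Definition SL2_opp A := MkSL2 (SL2_opp_subproof A).

Fact SL2_mulA : associative SL2_mul.
Proof. by move=> A B C; apply: val_inj; rewrite /= mulmxA. Qed.
Fact SL2_mul1 : left_id SL2_one SL2_mul.
Proof. by move=> A; apply: val_inj; rewrite /= mul1mx. Qed.
Fact SL2_mulr1 : right_id SL2_one SL2_mul.
Proof. by move=> A; apply: val_inj; rewrite /= mulmx1. Qed.
Fact SL2_mulV : left_inverse SL2_one SL2_inv SL2_mul.
Proof. by move=> A; apply: val_inj; rewrite /= mulVmx ?unit_SL2. Qed.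
Fact SL2_mulrV : right_inverse SL2_one SL2_inv SL2_mul.
Proof. by move=> A; apply: val_inj; rewrite /= mulmxV ?unit_SL2. Qed.

HB.instance Definition _ := isGroup.Build SL2
  SL2_mulA SL2_mul1 SL2_mulr1 SL2_mulV SL2_mulrV.

Definition eq_up_to_sign A B : bool := (A == B) || (A == SL2_opp B).

Lemma SL2_oppK : involutive SL2_opp.
Proof. by move=> A; apply: val_inj; rewrite /= opprK. Qed.

Fact eq_up_to_sign_refl : reflexive eq_up_to_sign.
Proof. by move=> A; rewrite /eq_up_to_sign eqxx. Qed.
Fact eq_up_to_sign_sym : symmetric eq_up_to_sign.
Proof.
move=> A B; rewrite /eq_up_to_sign eq_sym; congr (_ || _).
by rewrite -(inj_eq (can_inj SL2_oppK)) SL2_oppK eq_sym.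
Qed.
Fact eq_up_to_sign_trans : transitive eq_up_to_sign.
Proof.
move=> B A C /orP[]/eqP-> /orP[]/eqP->; rewrite /eq_up_to_sign ?SL2_oppK eqxx.
all: by rewrite ?orbT.
Qed.

Canonical eq_up_to_sign_equiv := EquivRel eq_up_to_sign
  eq_up_to_sign_refl eq_up_to_sign_sym eq_up_to_sign_trans.

Definition PSL2 : Type := {eq_quot eq_up_to_sign}.
HB.instance Definition _ := Choice.on PSL2.
HB.instance Definition _ : EqQuotient SL2 eq_up_to_sign PSL2 :=
  EqQuotient.on PSL2.

Definition PSL2_class A : PSL2 := \pi_PSL2 A.

Definition PSL2_one : PSL2 := PSL2_class 1%g.
Definition PSL2_mul (x y : PSL2) : PSL2 := PSL2_class (repr x * repr y)%g.
Definition PSL2_inv (x : PSL2) : PSL2 := PSL2_class (repr x)^-1%g.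

Lemma PSL2_classP A B :
  reflect (A = B \/ A = SL2_opp B) (PSL2_class A == PSL2_class B).
Proof.
rewrite /PSL2_class eqmodE.
by apply: (iffP orP) => -[/eqP|/eqP]; [left|right|left|right].
Qed.

Lemma repr_PSL2_class A :
  repr (PSL2_class A) = A \/ repr (PSL2_class A) = SL2_opp A.
Proof. by apply/PSL2_classP; rewrite /PSL2_class reprK. Qed.

Lemma PSL2_class_opp A : PSL2_class (SL2_opp A) = PSL2_class A.
Proof. by apply/eqP/PSL2_classP; right. Qed.

Lemma PSL2_classM A B :
  PSL2_mul (PSL2_class A) (PSL2_class B) = PSL2_class (A * B)%g.
Proof.
have oppMl X Y : (SL2_opp X * Y)%g = SL2_opp (X * Y)%g.
  by apply: val_inj; rewrite /= mulNmx.
have oppMr X Y : (X * SL2_opp Y)%g = SL2_opp (X * Y)%g.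
  by apply: val_inj; rewrite /= mulmxN.
rewrite /PSL2_mul; case: (repr_PSL2_class A) => ->.
all: by case: (repr_PSL2_class B) => ->; rewrite ?(oppMl, oppMr, PSL2_class_opp).
Qed.

Lemma PSL2_classV A : PSL2_inv (PSL2_class A) = PSL2_class (A^-1)%g.
Proof.
rewrite /PSL2_inv; case: (repr_PSL2_class A) => -> //.
rewrite -[RHS]PSL2_class_opp; congr PSL2_class; apply: val_inj => /=.
have uN : -1 *: (A : 'M_2) \in unitmx.
  by rewrite scaleN1r; exact: (unit_SL2 (SL2_opp A)).
by rewrite -[X in invmx X]scaleN1r invmxZ // invrN invr1 scaleN1r.
Qed.

Lemma PSL2_ind (Pr : PSL2 -> Prop) :
  (forall A, Pr (PSL2_class A)) -> forall x, Pr x.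
Proof. by move=> PrA x; rewrite -[x]reprK; apply: PrA. Qed.

Fact PSL2_mulA : associative PSL2_mul.
Proof.
by elim/PSL2_ind=> A; elim/PSL2_ind=> B; elim/PSL2_ind=> C;
  rewrite !PSL2_classM mulgA.
Qed.
Fact PSL2_mul1 : left_id PSL2_one PSL2_mul.
Proof. by elim/PSL2_ind=> A; rewrite PSL2_classM mul1g. Qed.
Fact PSL2_mulr1 : right_id PSL2_one PSL2_mul.
Proof. by elim/PSL2_ind=> A; rewrite PSL2_classM mulg1. Qed.
Fact PSL2_mulV : left_inverse PSL2_one PSL2_inv PSL2_mul.
Proof. by elim/PSL2_ind=> A; rewrite PSL2_classV PSL2_classM mulVg. Qed.
Fact PSL2_mulrV : right_inverse PSL2_one PSL2_inv PSL2_mul.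
Proof. by elim/PSL2_ind=> A; rewrite PSL2_classV PSL2_classM mulgV. Qed.

HB.instance Definition _ := isGroup.Build PSL2
  PSL2_mulA PSL2_mul1 PSL2_mulr1 PSL2_mulV PSL2_mulrV.

(* Action on the projective line option F, with None the point at infinity. *)
Definition mobius (A : 'M[F]_2) (z : option F) : option F :=
  let a := A 0 0 in let b := A 0 1 in let c := A 1 0 in let d := A 1 1 in
  match z with
  | None => if c == 0 then None else Some (a / c)
  | Some z => if c * z + d == 0 then None
              else Some ((a * z + b) / (c * z + d))
  end.

Lemma mobiusN (A : 'M[F]_2) : mobius (- A) =1 mobius A.
Proof.
case=> [z|] /=; rewrite !mxE.
  rewrite !mulNr -!opprD oppr_eq0; case: ifP => // _.
  by rewrite invrN mulrNN.
by rewrite oppr_eq0; case: ifP => // _; rewrite invrN mulrNN.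
Qed.

(* The next two notions do not depend on the chosen representative, which is
   only determined up to sign. *)
Definition fixes (g : PSL2) (z : option F) : Prop :=
  mobius (repr g : SL2) z = z.

Definition parabolic (g : PSL2) : Prop :=
  g <> 1%g /\ (\tr (repr g : SL2)) ^+ 2 = 4%:R.

Lemma fixes_class A z : fixes (PSL2_class A) z <-> mobius A z = z.
Proof. by rewrite /fixes; case: (repr_PSL2_class A) => ->; rewrite ?mobiusN. Qed.

Lemma parabolic_class A :
  parabolic (PSL2_class A) <-> PSL2_class A <> 1%g /\ (\tr A) ^+ 2 = 4%:R.
Proof.
rewrite /parabolic.
by case: (repr_PSL2_class A) => ->; rewrite //= raddfN /= sqrrN.
Qed.

Implicit Types (g h : PSL2) (G P Q : set PSL2).

Definition parabolic_subgroup G P : Prop :=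
  [/\ is_subgroup P, P `<=` G
    & exists z, forall g, P g -> g <> 1%g -> parabolic g /\ fixes g z].

Definition maximal_parabolic_subgroup G P : Prop :=
  parabolic_subgroup G P /\
  forall Q, parabolic_subgroup G Q -> P `<=` Q -> Q = P.

Definition primitive_parabolic G h : Prop :=
  [/\ G h, parabolic h
    & forall g (m : int), G g -> h = expgz g m -> m = 1 \/ m = -1].

(* At least k classes; a class is that of the cyclic subgroup <h>, so that h
   and its inverse are not distinguished. *)
Definition has_primitive_parabolic_classes (k : nat) G : Prop :=
  exists h : 'I_k -> PSL2,
    (forall i, primitive_parabolic G (h i)) /\
    (forall i j, i <> j ->
       ~ conjugate_in G (generated [set h i]) (generated [set h j])).

Definition parabolic_dust G : Prop := has_primitive_parabolic_classes 3 G.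

Definition mx22 (a b c d : F) : 'M[F]_2 :=
  \matrix_(i, j) if i == 0 then (if j == 0 then a else b)
                 else (if j == 0 then c else d).

Lemma det_mx22 a b c d : \det (mx22 a b c d) = a * d - b * c.
Proof.
rewrite (expand_det_row _ 0) !big_ord_recl big_ord0 addr0 /cofactor !det_mx11.
by rewrite !mxE /= expr0 expr1 mul1r mulN1r mulrN.
Qed.

Fact Smx_subproof : \det (mx22 1 0 1 1) == 1.
Proof. by rewrite det_mx22 mulr1 mul0r subr0. Qed.
Definition Smx : SL2 := MkSL2 Smx_subproof.

Fact Tmx_subproof (lambda : F) : \det (mx22 1 (2%:R * lambda) 0 1) == 1.
Proof. by rewrite det_mx22 mulr1 mulr0 subr0. Qed.
Definition Tmx (lambda : F) : SL2 := MkSL2 (Tmx_subproof lambda).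

Definition Ggroup (lambda : F) : set PSL2 :=
  generated [set PSL2_class Smx; PSL2_class (Tmx lambda)].

End SpecialLinear.

(* Main.v *)
Require Import Defs.
From HB Require Import structures.
From mathcomp Require Import all_boot all_order all_algebra.
From mathcomp Require Import all_classical all_reals.
From mathcomp Require Import complex.
From mathcomp Require Import ring zify.

Import GRing.Theory Num.Theory.
Local Open Scope ring_scope.

Set Implicit Arguments.
Unset Strict Implicit.
Unset Printing Implicit Defensive.

(** Put [i] for the square root of [-1] such that [2 lambda] is [1 + i] up to
    sign, and [w = 1 + i]. Then [G] is generated by [S : z |-> z / (z + 1)] and
    [T : z |-> z + w]; it is the group of the Whitehead link, with cusps at [0]
    and at infinity, and [S] and [T] are meridians of the two components.

    Every matrix in [G] has Gaussian integer entries with upper right entry in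
    [w Z[i]] ([whitehead_level]). So the translations [z |-> z + w x] in [G]
    have Gaussian [x], and no element of [G] maps infinity to [0], since that
    would make [w] a unit.

    Besides the meridian, each cusp has a longitude: explicit words of length
    seven are the translation by [w (1 - 2i)] and its counterpart at [0]
    ([upper_longitude_whitehead], [lower_longitude_whitehead]). The parabolic
    subgroup at each cusp is therefore a lattice between [Z + 2iZ] and [Z[i]],
    which gives two maximal parabolic subgroups [Z x Z], not conjugate because
    [0] and infinity lie in different orbits.

    The translations by [w (1 + 2ki)], for [k = 0, 1, 2, ...], are primitive,
    as no integer other than [1] and [-1] divides [1 + 2ki]. They lie in
    different classes: an element of [G] that conjugates one into a power of
    another fixes infinity, hence multiplies translation lengths by the square
    of a Gaussian unit, whereas the norms [1 + 4 k^2] are distinct. This gives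
    as many classes as desired ([whitehead_primitive_classes]).

    Finally [G] is not free since two commuting nontrivial elements of a free
    group have a common nontrivial power ([free_commuting]), which fails in
    [Z x Z]. That lemma is a cancellation argument on reduced words: after a
    conjugation two commuting elements are spelled by words [u] and [w] with
    [u ++ w = w ++ u], and then [u ^ |w|] and [w ^ |u|] are the same word. *)

(** * Generated subgroups *)

Section Subgroups.
Local Open Scope group_scope.
Variable gT : groupType.
Implicit Types (x y g : gT) (X G H : set gT).

Lemma is_subgroup_generated X : is_subgroup (generated X).
Proof.
split=> [H [[H1 _] _] //|x y Xx Xy H HX].
by case: (HX) => [[_ HV] _]; apply: HV; [apply: Xx | apply: Xy].
Qed.

Lemma mem_generated X x : X x -> generated X x.
Proof. by move=> Xx H [_]; apply. Qed.

Lemma generated_sub X H : is_subgroup H -> (X `<=` H)%classic ->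
  (generated X `<=` H)%classic.
Proof. by move=> sH XH x; apply; split. Qed.

Lemma subgroupV H x : is_subgroup H -> H x -> H x^-1.
Proof. by case=> H1 HV Hx; rewrite -[x^-1]mul1g; apply: HV. Qed.

Lemma subgroupM H x y : is_subgroup H -> H x -> H y -> H (x * y).
Proof.
by move=> sH Hx Hy; rewrite -[y]invgK; apply: (sH.2) => //; apply: subgroupV.
Qed.

Lemma subgroupXz H x m : is_subgroup H -> H x -> H (expgz x m).
Proof.
move=> sH Hx; have HX n : H (x ^+ n).
  elim: n => [|n IH]; first by rewrite expg0; exact: sH.1.
  by rewrite expgS; apply: subgroupM.
by case: m => n; [exact: HX | exact: (subgroupV sH (HX n.+1))].
Qed.

Lemma commute_expgz g m : commute g (expgz g m).
Proof. by case: m => n; [|apply: commuteV]; apply: commuteX. Qed.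

End Subgroups.

(** * Commuting elements of a free group *)

Section FreeGroups.
Local Open Scope group_scope.
Variable gT : groupType.
Implicit Types (x y a b : gT) (X G P : set gT) (l : gT * bool).
Implicit Types (u v w : seq (gT * bool)).

#[local] Arguments reduced {gT} w : simpl never.

Definition letterV l := (l.1, ~~ l.2).

Definition wordV w := rev (map letterV w).

Definition word_over X w := forall l, l \in w -> X l.1.

Lemma letterVK : involutive letterV.
Proof. by case=> x b; rewrite /letterV negbK. Qed.

Lemma value_letterV l : letter (letterV l) = (letter l)^-1.
Proof. by case: l => x [] /=; rewrite /letter //= invgK. Qed.

Lemma word_value_cons l w : word_value (l :: w) = letter l * word_value w.
Proof. by rewrite /word_value big_cons. Qed.

Lemma word_value_cat u v : word_value (u ++ v) = word_value u * word_value v.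
Proof. by rewrite /word_value big_cat. Qed.

Lemma word_value1 l : word_value [:: l] = letter l.
Proof. by rewrite /word_value big_seq1. Qed.

Lemma word_value_nil : word_value [::] = 1 :> gT.
Proof. by rewrite /word_value big_nil. Qed.

Lemma wordV_cons l w : wordV (l :: w) = rcons (wordV w) (letterV l).
Proof. by rewrite /wordV /= rev_cons. Qed.

Lemma word_valueV w : word_value (wordV w) = (word_value w)^-1.
Proof.
elim: w => [|l w IH]; first by rewrite /wordV word_value_nil invg1.
rewrite wordV_cons -cats1 word_value_cat word_value1 IH value_letterV.
by rewrite word_value_cons invgM.
Qed.

Lemma word_overV X w : word_over X w -> word_over X (wordV w).
Proof. by move=> Xw l; rewrite mem_rev => /mapP[l' l'w ->]; exact: (Xw l'). Qed.

Lemma word_over_cat X u v :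
  word_over X u -> word_over X v -> word_over X (u ++ v).
Proof. by move=> Xu Xv l; rewrite mem_cat => /orP[/Xu|/Xv]. Qed.

Lemma word_over_cons X l w :
  word_over X (l :: w) <-> X l.1 /\ word_over X w.
Proof.
split=> [Xw|[Xl Xw] l']; last by rewrite inE => /orP[/eqP->|/Xw].
by split=> [|l' l'w]; apply: Xw; rewrite inE ?eqxx ?l'w ?orbT.
Qed.

Lemma generated_word X x :
  generated X x -> exists2 w, word_over X w & word_value w = x.
Proof.
move: x; apply: generated_sub => [|x Xx]; last first.
  exists [:: (x, false)]; last by rewrite word_value1.
  by move=> l; rewrite inE => /eqP->.
split=> [|x y [u Xu <-] [v Xv <-]].
  by exists [::] => //; rewrite word_value_nil.
exists (u ++ wordV v); last by rewrite word_value_cat word_valueV.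
by apply: word_over_cat => //; apply: word_overV.
Qed.

Lemma reduced_step l l' :
  ~~ ((l.1 == l'.1) && (l.2 != l'.2)) = (l' != letterV l).
Proof.
case: l l' => [x b] [y c]; congr (~~ _); rewrite /letterV xpair_eqE eq_sym /=.
by case: b c => [] [].
Qed.

Lemma reducedE w : reduced w = sorted (fun l l' => l' != letterV l) w.
Proof. by apply: eq_sorted => l l'; apply: reduced_step. Qed.

Lemma reduced_cons2 l l' w :
  reduced (l :: l' :: w) = (l' != letterV l) && reduced (l' :: w).
Proof. by rewrite !reducedE. Qed.

Lemma reduced_behead l w : reduced (l :: w) -> reduced w.
Proof. by case: w => // l' w; rewrite reduced_cons2 => /andP[]. Qed.

Lemma reduced_cat u l l' v :
  reduced (rcons u l ++ l' :: v) =
  [&& reduced (rcons u l), l' != letterV l & reduced (l' :: v)].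
Proof.
elim: u => [|l0 u IH]; first by rewrite /= reduced_cons2.
case: u IH => [|l1 u] /= IH; rewrite reduced_cons2 IH.
  by rewrite [X in _ = X && _]reduced_cons2 -[reduced [:: l]]/true andbT.
by rewrite [X in _ = X && _]reduced_cons2 andbA.
Qed.

Lemma reducedV w : reduced (wordV w) = reduced w.
Proof.
elim: w => // l [//|l' w] IH.
rewrite !wordV_cons -[rcons _ (letterV l)]cats1 reduced_cat -wordV_cons IH.
by rewrite reduced_cons2 letterVK andbT [LHS]andbC eq_sym.
Qed.

(** Cancelling inverse neighbours one at a time shortens a word strictly as
    soon as something cancels; the last alternative records this, and it is
    what makes a length comparison decide whether a word is reduced. *)
Lemma exists_reduced X w : word_over X w ->
  exists w', [/\ word_over X w', reduced w', word_value w' = word_value w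
                & w' = w \/ (size w' < size w)%N].
Proof.
elim: w => [|l w IH] Xw; first by exists [::]; split=> //; left.
have /word_over_cons[Xl /IH[w' [Xw' rw' valw' sw']]] := Xw.
rewrite word_value_cons -valw'.
case: w' => [|l' w'] in Xw' rw' {valw'} sw' *.
  exists [:: l]; split=> //; last by case: sw' => [<-|]; [left | right].
    exact/word_over_cons.
  by rewrite word_value1 word_value_nil mulg1.
have [El'|nl'] := eqVneq l' (letterV l).
  exists w'; split.
  - by case/word_over_cons: Xw'.
  - exact: reduced_behead rw'.
  - by rewrite word_value_cons El' value_letterV mulVKg.
  - by right; case: sw' => [<-|/ltnW/ltnW] //=.
exists [:: l, l' & w']; split.
- exact/word_over_cons.
- by rewrite reduced_cons2 nl'.
- by rewrite [LHS]word_value_cons.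
- by case: sw' => [<-|sw']; [left | right].
Qed.

Section Basis.
Variables (X G : set gT).
Hypothesis XG : free_basis X G.

Let nontrivial w :
  word_over X w -> reduced w -> word_value w = 1 -> w = [::].
Proof.
move=> Xw rw w1; case: (eqVneq w [::]) => // /eqP w0.
by case: (XG.2 w Xw rw w0).
Qed.

(** From the first letter at which two reduced spellings differ, the inverse of
    the one followed by the other is reduced and spells [1]. *)
Lemma reduced_word_inj u v : word_over X u -> word_over X v ->
  reduced u -> reduced v -> word_value u = word_value v -> u = v.
Proof.
elim: u v => [|l u IH] v Xu Xv ru rv Euv.
  by rewrite [RHS]nontrivial // -Euv word_value_nil.
case: v => [|l' v] in Xv rv Euv *.
  by apply: nontrivial; rewrite // Euv word_value_nil.
have [Ell'|nll'] := eqVneq l' l.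
  move: Euv; rewrite Ell' in Xv rv *; rewrite !word_value_cons => /mulgI Euv.
  congr (_ :: _); apply: IH => //.
  - by case/word_over_cons: Xu.
  - by case/word_over_cons: Xv.
  - exact: reduced_behead ru.
  - exact: reduced_behead rv.
suff: wordV (l :: u) ++ l' :: v = [::].
  by rewrite wordV_cons; case: (wordV u).
apply: nontrivial.
- by apply: word_over_cat => //; apply: word_overV.
- by rewrite wordV_cons reduced_cat -wordV_cons reducedV letterVK ru rv nll'.
- by rewrite word_value_cat word_valueV Euv mulVg.
Qed.

(** The reduced word [u ++ w] has the same value and the same length as
    [w ++ u], so the latter cannot shorten and is reduced too. *)
Lemma commuting_words u w : word_over X u -> word_over X w ->
  reduced (u ++ w) -> commute (word_value u) (word_value w) ->
  u ++ w = w ++ u.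
Proof.
move=> Xu Xw ruw cuw.
have [w' [Xw' rw' valw' sw']] := exists_reduced (word_over_cat Xw Xu).
have Ew' : w' = u ++ w.
  apply: reduced_word_inj => //; first exact: word_over_cat.
  by rewrite valw' !word_value_cat cuw.
by case: sw' => [<-//|]; rewrite Ew' !size_cat addnC ltnn.
Qed.

End Basis.

Definition word_pow n w := iter n (cat w) [::].

Lemma word_value_pow n w : word_value (word_pow n w) = word_value w ^+ n.
Proof.
elim: n => [|n IH]; first by rewrite word_value_nil expg0.
by rewrite /= word_value_cat IH expgS.
Qed.

Lemma size_word_pow n w : size (word_pow n w) = (n * size w)%N.
Proof. by elim: n => // n IH; rewrite /= size_cat IH mulSn. Qed.

Lemma word_powC n u w : u ++ w = w ++ u ->
  u ++ word_pow n w = word_pow n w ++ u.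
Proof.
move=> uw; elim: n => [|n IH]; first by rewrite cats0.
by rewrite /= catA uw -!catA IH.
Qed.

(** The powers [u ^ |w|] and [w ^ |u|] have the same length, and commuting
    words of the same length are equal. *)
Lemma word_pow_size u w : u ++ w = w ++ u ->
  word_pow (size w) u = word_pow (size u) w.
Proof.
move=> uw; have /eqP := word_powC (size w) (esym (word_powC (size u) uw)).
by rewrite eqseq_cat ?size_word_pow 1?mulnC // eq_sym => /andP[/eqP].
Qed.

Definition common_power a b := exists m n : nat,
  [/\ (0 < m)%N, (0 < n)%N & a ^+ m = b ^+ n \/ a ^+ m = b ^- n].

Lemma common_powerJ x a b : common_power (a ^ x) (b ^ x) -> common_power a b.
Proof.
case=> m [n [m0 n0]]; rewrite -!conjXg -conjVg => Eab; exists m, n; split=> //.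
by case: Eab => /conjg_inj; [left | right].
Qed.

(** Conjugation makes the reduced word [w] cyclically reduced, so that its
    first letter and the inverse of its last one are not both inverse to the
    last letter of the reduced word [u] for [b]. Hence [u] can be followed by
    [w] or by the inverse of [w] without cancellation, and commutes with it as
    a word. *)
Lemma free_commuting X G w b : free_basis X G -> word_over X w ->
  reduced w -> w <> [::] -> generated X b -> b <> 1 ->
  commute b (word_value w) -> common_power b (word_value w).
Proof.
move=> XG; have [n] := ubnP (size w).
elim: n w b => // n IH w b; rewrite ltnS => lewn Xw rw w0 Xb b1 cbw.
case: w w0 => // l w _ in lewn Xw rw cbw *.
have [El|nl] := eqVneq (last l w) (letterV l).
  (* [w] begins and ends with inverse letters: conjugate them away. *)
  case/lastP: w => [|w l'] in lewn Xw rw cbw El *.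
    by case: l El {lewn Xw rw cbw} => x [].
  rewrite last_rcons in El; rewrite {l'}El in lewn Xw rw cbw *.
  have [Xl Xw'] := (word_over_cons _ _ _).1 Xw.
  have Ew : word_value w = word_value (l :: rcons w (letterV l)) ^ letter l.
    rewrite conjgE word_value_cons -cats1 word_value_cat word_value1.
    by rewrite value_letterV !mulgA mulVg mul1g mulgVK.
  have gX := is_subgroup_generated X.
  have Xl' : generated X (letter l).
    have Xl1 := mem_generated Xl.
    by rewrite /letter; case: l.2 => //; exact: (subgroupV gX Xl1).
  apply: (@common_powerJ (letter l)); rewrite -Ew; apply: IH.
  - by move: lewn; rewrite /= size_rcons => /ltnW.
  - by move=> l' l'w; apply: Xw'; rewrite mem_rcons inE l'w orbT.
  - move: rw; rewrite -rcons_cons -cats1.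
    case: w {lewn Xw cbw Xw' Ew} => // l' w /reduced_behead.
    by rewrite -cat_cons lastI reduced_cat => /and3P[].
  - by move=> Ew0; move: rw; rewrite Ew0 /= reduced_cons2 eqxx.
  - exact: (subgroupM gX (subgroupV gX Xl') (subgroupM gX Xb Xl')).
  - by move/eqP; rewrite conjg_eq1 => /eqP.
  - by rewrite Ew /commute -!conjMg cbw.
have [u0 Xu0 Eu0] := generated_word Xb.
have [u [Xu ru valu _]] := exists_reduced Xu0.
rewrite {}Eu0 in valu; rewrite -{}valu in b1 cbw *.
have common w1 : word_over X w1 -> reduced (u ++ w1) -> w1 <> [::] ->
    commute (word_value u) (word_value w1) ->
    exists m n : nat, [/\ (0 < m)%N, (0 < n)%N
      & word_value u ^+ m = word_value w1 ^+ n].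
  move=> Xw1 ruw1 w10 cuw1; exists (size w1), (size u); split.
  - by case: w1 w10 {Xw1 ruw1 cuw1}.
  - by case: u b1 {Xu ru ruw1 cuw1 cbw} => //; rewrite word_value_nil.
  - rewrite -!word_value_pow; congr word_value; apply: word_pow_size.
    exact: (commuting_words XG).
case/lastP: u => [|u l'] in Xu ru b1 cbw common *.
  by rewrite word_value_nil in b1.
have [El'|nl'] := eqVneq l (letterV l').
  have [] := common (wordV (l :: w)).
  - exact: word_overV.
  - have:= rw; rewrite -reducedV {1 2}lastI.
    rewrite /wordV map_rcons rev_rcons reduced_cat ru => ->.
    rewrite andbT (can2_eq letterVK letterVK) letterVK.
    apply: contraNneq nl => ->.
    by rewrite El' letterVK.
  - by rewrite wordV_cons; case: (wordV w).
  - by rewrite word_valueV; apply: commuteV.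
  move=> m [k [m0 k0 Emk]]; exists m, k; split=> //; right.
  by rewrite Emk word_valueV expVgn.
have [|//||m [k [m0 k0 Emk]]] := common (l :: w) Xw; last first.
- by exists m, k; split=> //; left.
- by [].
- by rewrite reduced_cat ru rw nl'.
Qed.

(** A free group has no subgroup [Z x Z]: the images of [(1, 0)] and [(0, 1)]
    would have a common nontrivial power. *)
Lemma iso_ZxZ_not_free G P :
  (P `<=` G)%classic -> iso_ZxZ P -> ~ is_free G.
Proof.
move=> PG [f [fD f_inj fP]] [X XG].
have f0 : f 0%R = 1 by apply: (@mulgI _ (f 0%R)); rewrite -fD addr0 mulg1.
have fG (u : int * int) : generated X (f u).
  by rewrite XG.1; apply: PG; rewrite -fP; exists u.
have f1 (u : int * int) : f u = 1 -> u = 0%R by rewrite -f0 => /f_inj.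
have fX (u : int * int) n : f u ^+ n = f (u *+ n)%R.
  by elim: n => [|n IH]; rewrite ?f0 // expgS IH mulrS fD.
have fV (u : int * int) : (f u)^-1 = f (- u)%R.
  by apply: mulg1_eq; rewrite -fD subrr.
have [w0 Xw0 Ew0] := generated_word (fG (0, 1)%R).
have [w [Xw rw valw _]] := exists_reduced Xw0.
have [||||m [n [m0 n0]]] := @free_commuting X G w (f (1, 0)%R) XG Xw rw.
- move=> w1; have /f1 // : f (0, 1)%R = 1.
  by rewrite -Ew0 -valw w1 word_value_nil.
- exact: fG.
- by move/f1.
- by rewrite /commute valw Ew0 -!fD addrC.
rewrite valw Ew0 !fX fV => -[] /f_inj/(congr1 fst) /eqP.
all: rewrite ?raddfN !raddfMn /= mul0rn ?oppr0 pnatr_eq0.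
all: by rewrite -leqn0 leqNgt m0.
Qed.

End FreeGroups.

(** * Parabolics fixing 0 or infinity *)

Section Cusps.
Variable F : fieldType.
Implicit Types (a b c d x y : F) (A B : SL2 F) (g h : PSL2 F) (z : option F).

Lemma mx22_eta (M : 'M[F]_2) : M = mx22 (M 0 0) (M 0 1) (M 1 0) (M 1 1).
Proof.
apply/matrixP => i j; rewrite mxE.
by case: i j => [[|[|//]] ?] [[|[|//]] ?] /=; congr (M _ _); apply: val_inj.
Qed.

Lemma mx22_inj a b c d a' b' c' d' : mx22 a b c d = mx22 a' b' c' d' ->
  [/\ a = a', b = b', c = c' & d = d'].
Proof.
move=> /matrixP E; split.
- by have := E 0 0; rewrite !mxE.
- by have := E 0 1; rewrite !mxE.
- by have := E 1 0; rewrite !mxE.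
- by have := E 1 1; rewrite !mxE.
Qed.

Lemma mx22M a b c d a' b' c' d' : mx22 a b c d *m mx22 a' b' c' d' =
  mx22 (a * a' + b * c') (a * b' + b * d') (c * a' + d * c') (c * b' + d * d').
Proof.
by rewrite [LHS]mx22_eta !mxE !big_ord_recl !big_ord0 !mxE /= !addr0.
Qed.

Lemma mx22N a b c d : - mx22 a b c d = mx22 (- a) (- b) (- c) (- d).
Proof. by rewrite [LHS]mx22_eta !mxE. Qed.

Lemma mxtrace22 a b c d : \tr (mx22 a b c d) = a + d.
Proof. by rewrite /mxtrace !big_ord_recl big_ord0 !mxE /= addr0. Qed.

Lemma SL2_det A a b c d : A = mx22 a b c d :> 'M_2 -> a * d - b * c = 1.
Proof. by move=> EA; rewrite -det_mx22 -EA det_SL2. Qed.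

Lemma SL2_invE A a b c d :
  A = mx22 a b c d :> 'M_2 -> invmx A = mx22 d (- b) (- c) a.
Proof.
move=> EA; have detA := SL2_det EA.
have detB : \det (mx22 d (- b) (- c) a) == 1.
  by rewrite det_mx22 mulrNN mulrC detA.
rewrite -[LHS]/(A^-1%g : 'M_2).
suff /mulg1_eq -> : (A * MkSL2 detB)%g = 1%g by [].
apply: val_inj; rewrite /= EA mx22M [RHS]mx22_eta !mxE /=.
by congr mx22; rewrite -?detA; ring.
Qed.

Lemma PSL2_P g :
  exists A a b c d, g = PSL2_class A /\ A = mx22 a b c d :> 'M_2.
Proof.
elim/PSL2_ind: g => A.
by exists A, (A 0 0), (A 0 1), (A 1 0), (A 1 1); split=> //; apply: mx22_eta.
Qed.

Lemma PSL2_class_inj A B a b c d a' b' c' d' :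
  A = mx22 a b c d :> 'M_2 -> B = mx22 a' b' c' d' :> 'M_2 ->
  PSL2_class A = PSL2_class B ->
  exists2 e, e ^+ 2 = 1
    & [/\ a = e * a', b = e * b', c = e * c' & d = e * d'].
Proof.
move=> EA EB /eqP/PSL2_classP[EAB|EAB].
  exists 1; rewrite ?expr1n // !mul1r.
  by apply: mx22_inj; rewrite -EA -EB EAB.
exists (-1); rewrite ?sqrrN ?expr1n // !mulN1r.
by apply: mx22_inj; rewrite -mx22N -EA -EB EAB.
Qed.

Fact upper_subproof x : \det (mx22 1 x 0 1) == 1.
Proof. by rewrite det_mx22 mulr1 mulr0 subr0. Qed.
Definition upper x : PSL2 F := PSL2_class (MkSL2 (upper_subproof x)).

Fact lower_subproof x : \det (mx22 1 0 x 1) == 1.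
Proof. by rewrite det_mx22 mulr1 mul0r subr0. Qed.
Definition lower x : PSL2 F := PSL2_class (MkSL2 (lower_subproof x)).

Lemma PSL2_classMg A B :
  (PSL2_class A * PSL2_class B)%g = PSL2_class (A * B)%g.
Proof. exact: PSL2_classM. Qed.

Lemma PSL2_classJ A B :
  (PSL2_class B ^ PSL2_class A)%g = PSL2_class (A^-1 * (B * A))%g.
Proof.
rewrite conjgE (PSL2_classMg B A) (_ : (_^-1)%g = PSL2_class A^-1%g).
  exact: PSL2_classM.
exact: PSL2_classV.
Qed.

Lemma PSL2_classVg A : (PSL2_class A)^-1%g = PSL2_class A^-1%g.
Proof. exact: PSL2_classV. Qed.

Lemma mx22_1 : (1%g : SL2 F) = mx22 1 0 0 1 :> 'M_2.
Proof. by rewrite [LHS]mx22_eta !mxE. Qed.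

(** What the study of a cusp uses of its translations; it holds at infinity for
    [upper], rescaled or not, and at [0] for [lower]. *)
Definition unipotent_at (u : F -> PSL2 F) z : Prop :=
  [/\ forall x y, u (x + y) = (u x * u y)%g,
      injective u,
      forall x, x != 0 -> parabolic (u x),
      forall x z', x != 0 -> (fixes (u x) z' <-> z' = z)
    & forall g, parabolic g -> fixes g z -> exists x, g = u x].

(** A matrix of determinant [1] and trace [2] up to sign has
    [(a - d)^2 = -4bc], so that the vanishing of [b] or of [c] forces its
    diagonal to be [(1, 1)] up to sign. *)
Lemma trace_sqr4 a b c d : a * d - b * c = 1 -> b * c = 0 ->
  (a + d) ^+ 2 = 4%:R -> d = a /\ a ^+ 2 = 1.
Proof.
move=> + bc0; rewrite bc0 subr0 => ad1 tr4.
suff /eqP : (a - d) ^+ 2 = 0.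
  by rewrite sqrf_eq0 subr_eq0 => /eqP Ead; split; rewrite // expr2 {2}Ead.
have -> : (a - d) ^+ 2 = (a + d) ^+ 2 - 4%:R * (a * d) by ring.
by rewrite tr4 ad1 mulr1 subrr.
Qed.

Lemma PSL2_class_sqr1 e A B a b c d : e ^+ 2 = 1 ->
  A = mx22 a b c d :> 'M_2 ->
  B = mx22 (e * a) (e * b) (e * c) (e * d) :> 'M_2 ->
  PSL2_class A = PSL2_class B.
Proof.
move=> /eqP; rewrite sqrf_eq1 => /orP[]/eqP-> EA EB; apply/eqP/PSL2_classP.
  by left; apply: val_inj; rewrite /= EA EB !mul1r.
by right; apply: val_inj; rewrite /= EA EB mx22N !mulN1r !opprK.
Qed.

Lemma upper_inj : injective upper.
Proof.
move=> x y /(@PSL2_class_inj _ _ 1 x 0 1 1 y 0 1) []// e _.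
by rewrite mulr1 => -[<-]; rewrite mul1r.
Qed.

Lemma lower_inj : injective lower.
Proof.
move=> x y /(@PSL2_class_inj _ _ 1 0 x 1 1 0 y 1) []// e _.
by rewrite mulr1 => -[<- _]; rewrite mul1r.
Qed.

Lemma upper0 : upper 0 = 1%g.
Proof. by congr PSL2_class; apply: val_inj; rewrite /= [RHS]mx22_1. Qed.

Lemma lower0 : lower 0 = 1%g.
Proof. by congr PSL2_class; apply: val_inj; rewrite /= [RHS]mx22_1. Qed.

Lemma upper_unipotent w : w != 0 -> unipotent_at (fun x => upper (w * x)) None.
Proof.
move=> w0; split=> [x y|x y|x x0|x z x0|g].
- rewrite PSL2_classMg; congr PSL2_class; apply: val_inj => /=.
  by rewrite mx22M; congr mx22; ring.
- by move/upper_inj/(mulfI w0).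
- apply/parabolic_class; rewrite mxtrace22; split; last by ring.
  rewrite -/(upper _) -upper0 => /upper_inj/eqP.
  by rewrite mulf_eq0 (negPf w0) (negPf x0).
- rewrite fixes_class; split=> [|->]; last by rewrite /= !mxE /= eqxx.
  case: z => // z; rewrite /= !mxE /= mul0r add0r oner_eq0 divr1 mul1r => -[].
  by move/eqP; rewrite -subr_eq0 addrC addKr mulf_eq0 (negPf w0) (negPf x0).
case: (PSL2_P g) => A [a [b [c [d [-> EA]]]]].
rewrite parabolic_class fixes_class EA mxtrace22 /= !mxE /=.
move=> [_ tr4]; case: eqP => // c0 _; subst c.
have [Ed a2] := trace_sqr4 (SL2_det EA) (mulr0 b) tr4; subst d.
exists (w^-1 * (a * b)); rewrite mulVKf //; apply: (PSL2_class_sqr1 a2 EA).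
by rewrite /= mulr0 -expr2 a2.
Qed.

Lemma lower_unipotent : unipotent_at lower (Some 0).
Proof.
split=> [x y||x x0|x z x0|g].
- rewrite PSL2_classMg; congr PSL2_class; apply: val_inj => /=.
  by rewrite mx22M; congr mx22; ring.
- exact: lower_inj.
- apply/parabolic_class; rewrite mxtrace22; split; last by ring.
  by rewrite -/(lower _) -lower0 => /lower_inj/eqP; rewrite (negPf x0).
- rewrite fixes_class; split=> [|->]; last first.
    by rewrite /= !mxE /= !mulr0 !add0r oner_eq0 mul0r.
  case: z => [z|]; rewrite /= !mxE /= ?(negPf x0) // mul1r addr0.
  case: eqP => // /eqP den0 [] /eqP.
  rewrite -[X in _ == X](mulfK den0) (inj_eq (mulIf (invr_neq0 den0))).
  rewrite mulrDr mulr1 -subr_eq0 opprD addrCA subrr addr0 oppr_eq0.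
  by rewrite !mulf_eq0 (negPf x0) orbb /= => /eqP->.
case: (PSL2_P g) => A [a [b [c [d [-> EA]]]]].
rewrite parabolic_class fixes_class EA mxtrace22 /= !mxE /= !mulr0 !add0r.
move=> [_ tr4]; case: eqP => // /eqP d0 [] /eqP.
rewrite mulf_eq0 invr_eq0 (negPf d0) orbF => /eqP b0; subst b.
have [Ed a2] := trace_sqr4 (SL2_det EA) (mul0r c) tr4; subst d.
exists (a * c); apply: (PSL2_class_sqr1 a2 EA).
by rewrite /= mulr0 -expr2 a2.
Qed.

(** Conjugating the matrix unit [E_01] by [A] gives the column [(d, -c)] times
    the row [(c, d)], so the lower left entry of the conjugate of [upper x] is
    [- c^2 x]. *)
Lemma upper_conj A a b c d x y : A = mx22 a b c d :> 'M_2 -> x != 0 ->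
  (upper x ^ PSL2_class A)%g = upper y -> c = 0 /\ d ^+ 2 * x = y.
Proof.
move=> EA x0; have adE : a * d = 1 + b * c by rewrite -(SL2_det EA) subrK.
rewrite /upper PSL2_classJ.
case/(PSL2_class_inj (a := 1 + d * c * x) (b := d ^+ 2 * x)
       (c := - (c ^+ 2 * x)) (d := 1 - c * d * x)
       (a' := 1) (b' := y) (c' := 0) (d' := 1)) => //.
  rewrite /= (SL2_invE EA) EA !mx22M.
  by congr mx22; ring: adE.
move=> e _; rewrite mulr0 mulr1 => -[ae -> /eqP ce _].
have c0 : c = 0.
  by apply/eqP; move: ce; rewrite oppr_eq0 mulf_eq0 (negPf x0) orbF sqrf_eq0.
by split=> //; rewrite -ae c0 mulr0 mul0r addr0 mul1r.
Qed.

(** The same computation with [E_10], which gives [a^2 x] as lower left entry. *)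
Lemma lower_conj_upper A a b c d x y : A = mx22 a b c d :> 'M_2 -> x != 0 ->
  (lower x ^ PSL2_class A)%g = upper y -> a = 0.
Proof.
move=> EA x0; have adE : a * d = 1 + b * c by rewrite -(SL2_det EA) subrK.
rewrite /lower /upper PSL2_classJ.
case/(PSL2_class_inj (a := 1 - b * a * x) (b := - (b ^+ 2 * x))
       (c := a ^+ 2 * x) (d := 1 + a * b * x)
       (a' := 1) (b' := y) (c' := 0) (d' := 1)) => //.
  rewrite /= (SL2_invE EA) EA !mx22M.
  by congr mx22; ring: adE.
move=> e _; rewrite mulr0 => -[_ _ /eqP ce _].
by apply/eqP; move: ce; rewrite mulf_eq0 (negPf x0) orbF sqrf_eq0.
Qed.

(** An element that commutes with a translation has [c = 0] and [d^2 = 1] by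
    [upper_conj], which makes it a translation itself. *)
Lemma upper_centralizer A a b c d x : A = mx22 a b c d :> 'M_2 -> x != 0 ->
  commute (PSL2_class A) (upper x) -> PSL2_class A = upper (d * b).
Proof.
move=> EA x0 cAx; have [] := @upper_conj A a b c d x x EA x0.
  by rewrite conjgE -cAx mulKg.
move=> c0 /eqP; rewrite -[X in _ == X]mul1r (inj_eq (mulIf x0)) => /eqP d2.
apply: (PSL2_class_sqr1 d2 EA) => /=; rewrite -expr2 d2 c0 mulr0.
by rewrite (_ : d * a = 1) // mulrC -(SL2_det EA) c0 mulr0 subr0.
Qed.

End Cusps.

Arguments upper {F} x.
Arguments lower {F} x.

(** * Gaussian integers *)

Section Gaussian.
Variables (F : numFieldType) (i : F).
Hypothesis i2 : i ^+ 2 = -1.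
Implicit Types (p q r s j k m n : int) (x y : F).

Definition gint p q : F := p%:~R + q%:~R * i.

Definition gaussian x := exists p q, x = gint p q.

Lemma gint_int m : gint m 0 = m%:~R.
Proof. by rewrite /gint mul0r addr0. Qed.

Lemma gintM p q r s :
  gint p q * gint r s = gint (p * r - q * s) (p * s + q * r).
Proof. by rewrite /gint !(rmorphB, rmorphD, rmorphM) /=; ring: i2. Qed.

Lemma gintB p q r s : gint p q - gint r s = gint (p - r) (q - s).
Proof. by rewrite /gint !rmorphB /=; ring. Qed.

Lemma gint_eq0 p q : gint p q = 0 -> p = 0 /\ q = 0.
Proof.
move=> E0; have /eqP : gint p q * gint p (- q) = 0 by rewrite E0 mul0r.
rewrite gintM (_ : p * - q + q * p = 0); last by ring.
rewrite /gint mul0r addr0 intr_eq0 => /eqP N0; split; nia.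
Qed.

Lemma gint_inj p q r s : gint p q = gint r s -> p = r /\ q = s.
Proof.
move/eqP; rewrite -subr_eq0 gintB => /eqP/gint_eq0[/eqP + /eqP].
by rewrite !subr_eq0 => /eqP-> /eqP->.
Qed.

Lemma gaussian_gint p q : gaussian (gint p q). Proof. by exists p, q. Qed.

Lemma gaussianM x y : gaussian x -> gaussian y -> gaussian (x * y).
Proof.
by move=> [p [q ->]] [r [s ->]]; rewrite gintM; apply: gaussian_gint.
Qed.

Lemma gaussianB x y : gaussian x -> gaussian y -> gaussian (x - y).
Proof.
by move=> [p [q ->]] [r [s ->]]; rewrite gintB; apply: gaussian_gint.
Qed.

Lemma gaussian0 : gaussian 0.
Proof. by exists 0, 0; rewrite gint_int. Qed.

Lemma gaussian1 : gaussian 1.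
Proof. by exists 1, 0; rewrite gint_int. Qed.

Lemma gaussianN x : gaussian x -> gaussian (- x).
Proof. by rewrite -sub0r; apply: gaussianB; apply: gaussian0. Qed.

(** The norm of a unit is a positive integer that divides [1]. *)
Lemma gaussian_unit_norm p q y :
  gaussian y -> gint p q * y = 1 -> p ^+ 2 + q ^+ 2 = 1.
Proof.
move=> [r [s ->]]; rewrite gintM -[RHS](gint_int 1) => /gint_inj[E1 E0].
have N1 : (p ^+ 2 + q ^+ 2) * (r ^+ 2 + s ^+ 2) = 1.
  have -> : (p ^+ 2 + q ^+ 2) * (r ^+ 2 + s ^+ 2)
    = (p * r - q * s) ^+ 2 + (p * s + q * r) ^+ 2 by ring.
  by rewrite E1 E0.
have := addr_ge0 (sqr_ge0 p) (sqr_ge0 q).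
have := addr_ge0 (sqr_ge0 r) (sqr_ge0 s).
move: (p ^+ 2 + q ^+ 2) (r ^+ 2 + s ^+ 2) N1 => [a|//] [b|//].
by rewrite -PoszM => -[] /eqP; rewrite muln_eq1 => /andP[/eqP->].
Qed.

(** [1 + i] has norm [2], so it is not a unit. *)
Lemma gaussian_1i_not_unit x y :
  gaussian x -> gaussian y -> (1 + i) * x * y <> 1.
Proof.
move=> gx gy; rewrite -mulrA (_ : 1 + i = gint 1 1) ?mul1r //; last first.
  by rewrite /gint mul1r.
by move/(gaussian_unit_norm (gaussianM gx gy)).
Qed.

(** The integer [m] divides the real part [1]. *)
Lemma gint1_primitive q y m :
  gaussian y -> gint 1 q = y *~ m -> m = 1 \/ m = -1.
Proof.
move=> [r [s ->]]; rewrite -mulrzr -gint_int.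
rewrite gintM => /gint_inj[/(congr1 absz)/esym/eqP + _].
by rewrite mulr0 subr0 abszM muln_eq1 => /andP[_ /eqP m1]; lia.
Qed.

(** Multiplication by the units [p + qi] and [m] preserves the norm, which is
    [1 + 4 j^2] on the left and [1 + 4 k^2] on the right. *)
Lemma gint1_associate p q j k m : p ^+ 2 + q ^+ 2 = 1 -> m = 1 \/ m = -1 ->
  gint p q ^+ 2 * gint 1 (j *+ 2) = gint 1 (k *+ 2) *~ m -> j ^+ 2 = k ^+ 2.
Proof.
move=> N1 m1; rewrite expr2 -mulrzr -gint_int.
rewrite !gintM => /gint_inj[E1 E2].
have : (p ^+ 2 + q ^+ 2) ^+ 2 * (1 + (j *+ 2) ^+ 2)
    = m ^+ 2 * (1 + (k *+ 2) ^+ 2).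
  have -> : m ^+ 2 * (1 + (k *+ 2) ^+ 2) =
    (1 * m - k *+ 2 * 0) ^+ 2 + (1 * 0 + k *+ 2 * m) ^+ 2 by ring.
  by rewrite -E1 -E2; ring.
have -> : m ^+ 2 = 1 by case: m1 => ->.
rewrite N1 expr1n !mul1r => /addrI; rewrite !exprMn_n.
by move/(pmulrnI (isT : (0 < 4)%N)).
Qed.

End Gaussian.

(** * Rank two cusps *)

Section Lattices.
Local Open Scope group_scope.
Variables (F : numFieldType) (i : F).
Hypothesis i2 : (i ^+ 2 = -1)%R.
Variables (u : F -> PSL2 F) (z : option F) (H : set (PSL2 F)).
Hypothesis uz : unipotent_at u z.
Hypothesis sH : is_subgroup H.

Definition cusp_group : set (PSL2 F) :=
  [set g | H g /\ exists x, g = u x]%classic.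

Let uD x y : u (x + y) = u x * u y. Proof. by case: uz. Qed.

Lemma unipotent0 : u 0 = 1.
Proof. by apply: (@mulgI _ (u 0)); rewrite -uD addr0 mulg1. Qed.

Lemma unipotentV x : (u x)^-1 = u (- x).
Proof. by apply: mulg1_eq; rewrite -uD subrr unipotent0. Qed.

Lemma unipotentX x n : u x ^+ n = u (x *+ n).
Proof.
elim: n => [|n IH]; first by rewrite expg0 mulr0n unipotent0.
by rewrite expgS IH mulrS uD.
Qed.

Lemma unipotentXz x m : expgz (u x) m = u (x *~ m).
Proof. by case: m => n; rewrite /= ?unipotentV unipotentX ?unipotentV. Qed.

(** A parabolic subgroup that contains [u 1] fixes the only fixed point [z] of
    [u 1]. *)
Lemma cusp_maximal : H (u 1) -> maximal_parabolic_subgroup H cusp_group.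
Proof.
move=> H1; have [_ u_inj u_par u_fix u_ex] := uz.
split=> [|Q [sQ QH [z' Qz']] PQ].
  split.
  - split=> [|g h [Hg [x Eg]] [Hh [y Eh]]].
      by split; [exact: sH.1 | exists 0%R; rewrite unipotent0].
    split; first exact: sH.2.
    by exists (x - y)%R; rewrite Eg Eh unipotentV uD.
  - by move=> g [].
  - exists z => g [Hg [x Eg]] g1; rewrite Eg.
    have x0 : x != 0%R.
      by apply: contra_notN g1 => /eqP x0; rewrite Eg x0 unipotent0.
    by split; [exact: u_par | apply/(u_fix _ _ x0)].
have u1 : u 1 <> 1.
  by rewrite -unipotent0 => /u_inj/eqP; rewrite oner_eq0.
have Ez : z' = z.
  have Qu1 : Q (u 1) by apply: PQ; split=> //; exists 1%R.
  by have [_ /(u_fix _ _ (oner_neq0 F))] := Qz' _ Qu1 u1.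
rewrite {}Ez in Qz'.
apply/seteqP; split=> // g Qg; split; first exact: QH.
have [->|/eqP g1] := eqVneq g 1; first by exists 0%R; rewrite unipotent0.
by have [gp gz] := Qz' _ Qg g1; apply: u_ex.
Qed.

(** The translations in [H] form a lattice between [Z + 2iZ] and [Z + iZ],
    hence one of these two, since the index is [2]. *)
Lemma cusp_iso_ZxZ : H (u 1) -> H (u (gint i 1 (- 2))) ->
  (forall x, H (u x) -> gaussian i x) -> iso_ZxZ cusp_group.
Proof.
move=> H1 H2 HG; have [_ u_inj _ _ _] := uz.
have HB x y : H (u x) -> H (u y) -> H (u (x - y)%R).
  by move=> Hx Hy; rewrite uD -unipotentV; apply: sH.2.
have HZ x m : H (u x) -> H (u (x *~ m)).
  by move=> Hx; rewrite -unipotentXz; apply: subgroupXz.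
have H2i : H (u (gint i 0 2)).
  have -> : gint i 0 2 = (1 - gint i 1 (- 2))%R by rewrite /gint; ring.
  exact: HB.
have [k [k0 Hk Gk]] : exists k : int, [/\ k <> 0%R, H (u (gint i 0 k))
    & forall p q, H (u (gint i p q)) -> exists n, (q = n * k)%R].
  have [Hi|nHi] := EM (H (u (gint i 0 1))).
    by exists 1%R; split=> // p q _; exists q; rewrite mulr1.
  exists 2%R; split=> // p q Hpq.
  have := divz_eq q 2; move: (q %/ 2)%Z => t Eq; exists t.
  rewrite {1}Eq; suff -> : (q %% 2 = 0)%Z by rewrite addr0.
  (* If [q] is odd, subtracting an integer and a multiple of [2i] leaves [i]. *)
  have : (q %% 2 = 0)%Z \/ (q %% 2 = 1)%Z by lia.
  case=> // q1; case: nHi.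
  have -> : gint i 0 1 = (gint i p q - 1 *~ p - gint i 0 2 *~ t)%R.
    by rewrite Eq q1 /gint; ring.
  exact: (HB _ _ (HB _ _ Hpq (HZ _ _ H1)) (HZ _ _ H2i)).
exists (fun v : int * int => u (gint i v.1 (v.2 * k))); split.
- move=> [p q] [r s]; rewrite -uD; congr u.
  by rewrite /gint /= mulrDl !rmorphD /=; ring.
- move=> [p q] [r s] /u_inj/(gint_inj i2) /= [-> /eqP].
  by rewrite (inj_eq (mulIf _)) ?(introN eqP k0) // => /eqP ->.
apply/seteqP; split=> [_ [[p q] _ <-] /=|g [Hg [x Ex]]].
  split; last by eexists.
  have -> : gint i p (q * k) = (1 *~ p - gint i 0 k *~ (- q))%R.
    by rewrite /gint; ring.
  exact: (HB _ _ (HZ _ _ H1) (HZ _ _ Hk)).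
rewrite Ex in Hg *; have [p [q Exx]] := HG x Hg; rewrite Exx in Hg *.
have [n ->] := Gk p q Hg.
by exists (p, n).
Qed.

End Lattices.

(** * The group generated by [lower 1] and [upper (1 + i)] *)

Section Whitehead.
Local Open Scope group_scope.
Variables (F : numFieldType) (i : F).
Hypothesis i2 : (i ^+ 2 = -1)%R.

Let w : F := (1 + i)%R.
Let upperw (x : F) := upper (w * x)%R.

(** Up to conjugation and orientation, this is the holonomy group of the
    hyperbolic structure on the complement of the Whitehead link. *)
Definition whitehead_group : set (PSL2 F) :=
  generated [set lower (1 : F)%R; upper (1 + i)%R].

Let H := whitehead_group.
Let sH : is_subgroup H. Proof. exact: is_subgroup_generated. Qed.

Let w_gint : w = gint i 1 1. Proof. by rewrite /gint mul1r. Qed.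

Let w0 : w != 0%R.
Proof. by apply/eqP; rewrite w_gint => /(gint_eq0 i2)[]. Qed.

Lemma lower1_whitehead : H (lower 1%R).
Proof. by apply: mem_generated; left. Qed.

Lemma upper1_whitehead : H (upperw 1%R).
Proof. by rewrite /upperw mulr1; apply: mem_generated; right. Qed.

Let loU := lower_unipotent F.
Let upU := upper_unipotent w0.

(** With [S] and [T] the generators [lower 1] and [upper w], the longitude of
    the cusp at infinity is the word [S T^-1 S^-1 T S^-1 T^-1 S], which as a
    matrix is the opposite of the translation by [w (1 - 2i)]. *)
Lemma upper_longitude_whitehead : H (upperw (gint i 1 (- 2))).
Proof.
pose U (x : F) := MkSL2 (upper_subproof x).
pose L (x : F) := MkSL2 (lower_subproof x).
have HS := lower1_whitehead; have HT := upper1_whitehead.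
have HSV := subgroupV sH HS; have HTV := subgroupV sH HT.
rewrite (unipotentV loU) in HSV; rewrite (unipotentV upU) in HTV.
have -> : upperw (gint i 1 (- 2)) =
    lower 1%R * (upperw (- 1)%R * (lower (- 1)%R * (upperw 1%R *
      (lower (- 1)%R * (upperw (- 1)%R * lower 1%R))))).
  transitivity (PSL2_class (L 1%R * (U (w * -1)%R * (L (-1)%R * (U (w * 1)%R *
      (L (-1)%R * (U (w * -1)%R * L 1%R)))))));
    last by rewrite -!PSL2_classMg.
  apply: (@PSL2_class_sqr1 _ (- 1)%R); rewrite ?sqrrN ?expr1n //.
  by rewrite /= !mx22M /w /gint; congr mx22; ring: i2.
by do !apply: (subgroupM sH).
Qed.

(** Conjugation by the antidiagonal matrix with entries [r] and [- r^-1],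
    where [r^2 = - w], exchanges [upper (w x)] with [lower x], in particular
    [S] with [T]; it takes the longitude at infinity to this one. *)
Lemma lower_longitude_whitehead : H (lower (gint i 1 (- 2))).
Proof.
pose U (x : F) := MkSL2 (upper_subproof x).
pose L (x : F) := MkSL2 (lower_subproof x).
have HS := lower1_whitehead; have HT := upper1_whitehead.
have HSV := subgroupV sH HS; have HTV := subgroupV sH HT.
rewrite (unipotentV loU) in HSV; rewrite (unipotentV upU) in HTV.
have -> : lower (gint i 1 (- 2)) =
    upperw 1%R * (lower (- 1)%R * (upperw (- 1)%R * (lower 1%R *
      (upperw (- 1)%R * (lower (- 1)%R * upperw 1%R))))).
  transitivity (PSL2_class (U (w * 1)%R * (L (-1)%R * (U (w * -1)%R * (L 1%R *
      (U (w * -1)%R * (L (-1)%R * U (w * 1)%R)))))));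
    last by rewrite -!PSL2_classMg.
  apply: (@PSL2_class_sqr1 _ (- 1)%R); rewrite ?sqrrN ?expr1n //.
  by rewrite /= !mx22M /w /gint; congr mx22; ring: i2.
by do !apply: (subgroupM sH).
Qed.

(** The congruence subgroup of the Gaussian modular group that contains
    [whitehead_group]: the matrices that are lower triangular modulo [1 + i]. *)
Definition level_1i : set (PSL2 F) := [set g | exists A a b c d,
  [/\ g = PSL2_class A, A = mx22 a (w * b) c d :> 'M_2,
      gaussian i a /\ gaussian i b & gaussian i c /\ gaussian i d]]%classic.

Lemma level_1i_subgroup : is_subgroup level_1i.
Proof.
have g0 := gaussian0 i; have g1 := gaussian1 i.
have gw : gaussian i w by rewrite w_gint; apply: gaussian_gint.
split.
  exists 1, 1%R, 0%R, 0%R, 1%R; rewrite mulr0.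
  by split=> //; exact: mx22_1.
move=> _ _ [A [a [b [c [d [-> EA [ga gb] [gc gd]]]]]]]
  [B [a' [b' [c' [d' [-> EB [ga' gb'] [gc' gd']]]]]]].
exists (A * B^-1), (a * d' - w * b * c')%R, (b * a' - a * b')%R.
exists (c * d' - d * c')%R, (d * a' - w * c * b')%R; split.
- rewrite (_ : (PSL2_class B)^-1 = PSL2_class B^-1) ?PSL2_classMg //.
  exact: PSL2_classVg.
- by rewrite /= EA (SL2_invE EB) mx22M; congr mx22; ring.
- by split; apply: gaussianB => //; do !apply: gaussianM.
- by split; apply: gaussianB => //; do !apply: gaussianM.
Qed.

Lemma whitehead_level : (H `<=` level_1i)%classic.
Proof.
have g0 := gaussian0 i; have g1 := gaussian1 i.
apply: (generated_sub level_1i_subgroup) => _ [] ->.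
  exists (MkSL2 (lower_subproof 1%R)), 1%R, 0%R, 1%R, 1%R.
  by split; rewrite //= mulr0.
exists (MkSL2 (upper_subproof w)), 1%R, 1%R, 0%R, 1%R.
by split; rewrite //= mulr1.
Qed.

Lemma upper_whitehead_gaussian x : H (upperw x) -> gaussian i x.
Proof.
move=> /whitehead_level[A [a [b [c [d [E EA [ga gb] _]]]]]].
have [e e2 [ae /eqP be _ _]] :=
  PSL2_class_inj (A := MkSL2 (upper_subproof _)) erefl EA E.
move: be; rewrite mulrCA (inj_eq (mulfI w0)) => /eqP ->.
have -> : e = a by rewrite -[LHS]mulr1 ae mulrA -expr2 e2 mul1r.
exact: gaussianM.
Qed.

Lemma lower_whitehead_gaussian x : H (lower x) -> gaussian i x.
Proof.
move=> /whitehead_level[A [a [b [c [d [E EA [ga _] [gc _]]]]]]].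
have [e e2 [ae _ -> _]] :=
  PSL2_class_inj (A := MkSL2 (lower_subproof _)) erefl EA E.
have -> : e = a by rewrite -[LHS]mulr1 ae mulrA -expr2 e2 mul1r.
exact: gaussianM.
Qed.

Lemma lower_cusp_whitehead :
  maximal_parabolic_subgroup H (cusp_group lower H) /\
  iso_ZxZ (cusp_group lower H).
Proof.
split; first exact: cusp_maximal loU sH lower1_whitehead.
exact: (cusp_iso_ZxZ i2 loU sH lower1_whitehead lower_longitude_whitehead
  (@lower_whitehead_gaussian)).
Qed.

Lemma upper_cusp_whitehead :
  maximal_parabolic_subgroup H (cusp_group upperw H) /\
  iso_ZxZ (cusp_group upperw H).
Proof.
split; first exact: cusp_maximal upU sH upper1_whitehead.
exact: (cusp_iso_ZxZ i2 upU sH upper1_whitehead upper_longitude_whitehead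
  (@upper_whitehead_gaussian)).
Qed.

(** An element of the group that maps infinity to [0] would have upper left
    entry [0], and then its upper right entry would be a unit divisible by
    [1 + i]. *)
Lemma cusps_not_conjugate :
  ~ conjugate_in H (cusp_group lower H) (cusp_group upperw H).
Proof.
case=> g /whitehead_level[A [a [b [c [d [-> EA [ga gb] [gc gd]]]]]]] E.
have : cusp_group upperw H (lower 1%R ^ PSL2_class A).
  rewrite E; exists (lower 1%R) => //.
  by split; [exact: lower1_whitehead | exists 1%R].
case=> _ [y /(lower_conj_upper EA (oner_neq0 F)) a0].
have /eqP := SL2_det EA; rewrite a0 mul0r sub0r -mulrN => /eqP.
exact: (gaussian_1i_not_unit i2 gb (gaussianN gc)).
Qed.

(** A root of a nontrivial translation commutes with it and hence is itself a
    translation, by a Gaussian multiple of [w]. *)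
Lemma upper_whitehead_primitive (k : int) : H (upperw (gint i 1 k)) ->
  primitive_parabolic H (upperw (gint i 1 k)).
Proof.
have x0 : gint i 1 k != 0%R by apply/eqP => /(gint_eq0 i2)[].
have [_ u_inj u_par _ _] := upU; move=> Hk; split=> //; first exact: u_par.
move=> g m Hg Eg; have cg : commute g (upperw (gint i 1 k)).
  by rewrite Eg; apply: commute_expgz.
have [A [a [b [c [d [Eg' EA [ga gb] [gc gd]]]]]]] := whitehead_level Hg.
rewrite Eg' in cg Eg.
have EU := upper_centralizer EA (mulf_neq0 w0 x0) cg.
rewrite {}EU mulrCA (unipotentXz upU) in Eg.
apply: (gint1_primitive i2 (gaussianM i2 gd gb)).
exact: u_inj Eg.
Qed.

Lemma generated_unipotent u z (x : F) g : unipotent_at u z ->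
  generated [set u x] g -> exists m, g = u (x *~ m).
Proof.
move=> uz; move: g; apply: generated_sub => [|_ ->]; last first.
  by exists 1%R; rewrite mulr1z.
split=> [|_ _ [m ->] [n ->]].
  by exists 0%R; rewrite mulr0z (unipotent0 uz).
exists (m - n)%R; rewrite (unipotentV uz) mulrzBr.
by case: uz => ->.
Qed.

Lemma upper_whitehead_even (k : int) : H (upperw (gint i 1 (k *+ 2))).
Proof.
have -> : gint i 1 (k *+ 2) = (1 *~ (k + 1) + gint i 1 (- 2) *~ (- k))%R.
  by rewrite /gint; ring.
have [uD _ _ _ _] := upU; rewrite /upperw uD -!(unipotentXz upU).
apply: (subgroupM sH); apply: (subgroupXz _ sH).
  exact: upper1_whitehead.
exact: upper_longitude_whitehead.
Qed.

(** The representatives are the translations by [w (1 + 2ki)]. A conjugation in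
    the group between two of the cyclic groups that they generate fixes
    infinity, so it multiplies translation lengths by the square of a Gaussian
    unit and preserves the norm [1 + 4 k^2]. *)
Lemma whitehead_primitive_classes n : has_primitive_parabolic_classes n H.
Proof.
pose x (k : 'I_n) := gint i 1 (k%:Z *+ 2).
have x0 k : x k != 0%R by apply/eqP => /(gint_eq0 i2)[].
exists (fun k => upperw (x k)); split=> [k|j k njk [g Hg E]].
  exact: (upper_whitehead_primitive (upper_whitehead_even _)).
have [A [a [b [c [d [Eg EA [ga gb] [gc gd]]]]]]] := whitehead_level Hg.
have : generated [set upperw (x k)] (upperw (x j) ^ g).
  by rewrite E; exists (upperw (x j)) => //; apply: mem_generated.
case/(generated_unipotent upU) => m; rewrite Eg.
case/(upper_conj EA (mulf_neq0 w0 (x0 j))) => c0.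
rewrite mulrCA => /(mulfI w0) Em.
have ad1 : (d * a = 1)%R by rewrite mulrC -(SL2_det EA) c0 mulr0 subr0.
have m1 : m = 1%R \/ m = (- 1)%R.
  apply: (gint1_primitive (q := j%:Z *+ 2) i2 (y := a ^+ 2 * x k)%R).
    by rewrite expr2; do !apply: gaussianM => //; apply: gaussian_gint.
  by rewrite -mulrzAr -Em mulrA -exprMn (mulrC a) ad1 expr1n mul1r.
have [p [q Ed]] := gd; rewrite Ed in ad1 Em.
have N1 := gaussian_unit_norm i2 ga ad1.
apply: njk; apply: val_inj => /=.
by have := gint1_associate i2 N1 m1 Em; nia.
Qed.

Lemma whitehead_not_free : ~ is_free H.
Proof.
apply: (iso_ZxZ_not_free _ upper_cusp_whitehead.2).
by move=> g [].
Qed.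

End Whitehead.

(** * The groups [Ggroup lambda] *)

Lemma generated_pairV (gT : groupType) (x y : gT) :
  generated [set x; y^-1%g] = generated [set x; y].
Proof.
have sub z : (generated [set x; z^-1%g] `<=` generated [set x; z])%classic.
  apply: generated_sub (is_subgroup_generated _) _ => _ [] ->.
    by apply: mem_generated; left.
  apply: (subgroupV (is_subgroup_generated _)).
  by apply: mem_generated; right.
apply/seteqP; split; first exact: sub.
by rewrite -{1}[y]invgK; apply: sub.
Qed.

Lemma Ggroup_generated (F : fieldType) (lambda : F) :
  Ggroup lambda = generated [set lower 1; upper (2%:R * lambda)].
Proof.
rewrite /Ggroup; congr (generated [set _; _]).
  by congr PSL2_class; apply: val_inj.
by congr PSL2_class; apply: val_inj.
Qed.

(** Opposite values of [lambda] give the same group because [upper (- x)] is the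
    inverse of [upper x]. *)
Lemma Ggroup_whitehead (F : numFieldType) (i lambda : F) (s : bool) :
  2%:R * lambda = (-1) ^+ s * (1 + i) -> Ggroup lambda = whitehead_group i.
Proof.
rewrite Ggroup_generated => ->.
case: s; rewrite ?expr0 ?mul1r // expr1 mulN1r /whitehead_group.
rewrite -[RHS]generated_pairV; congr (generated [set _; _]).
apply/esym/mulg1_eq; rewrite PSL2_classMg -upper0; congr PSL2_class.
by apply: val_inj; rewrite /= mx22M; congr mx22; ring.
Qed.

Theorem theorem7p3 (R : realType) (s t : bool) (lambda : R[i])
    (lambdaE : lambda = ((-1) ^+ s + (-1) ^+ t * 'i%C) / 2%:R) :
  [/\ parabolic_dust (Ggroup lambda),
      ~ is_free (Ggroup lambda),
      exists P1 P2 : set (PSL2 R[i]),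
        [/\ maximal_parabolic_subgroup (Ggroup lambda) P1,
            maximal_parabolic_subgroup (Ggroup lambda) P2,
            iso_ZxZ P1, iso_ZxZ P2
          & ~ conjugate_in (Ggroup lambda) P1 P2]
    & has_primitive_parabolic_classes 4 (Ggroup lambda)].
Proof.
pose i : R[i] := (-1) ^+ s * (-1) ^+ t * 'i%C.
have i2 : i ^+ 2 = -1 by rewrite !exprMn !sqrr_sign !mul1r sqr_i.
rewrite (@Ggroup_whitehead _ i lambda s); last first.
  rewrite lambdaE mulrC mulfVK ?pnatr_eq0 // mulrDr mulr1 /i !mulrA.
  by rewrite -signr_addb addbb expr0 mul1r.
have [max0 iso0] := lower_cusp_whitehead i2.
have [maxoo isooo] := upper_cusp_whitehead i2.
split; [| exact: whitehead_not_free | | ].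
- exact: whitehead_primitive_classes.
- by eexists; eexists; split; [exact: max0 | exact: maxoo | exact: iso0
    | exact: isooo | exact: cusps_not_conjugate].
- exact: whitehead_primitive_classes.
Qed.
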